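(* Let $\mathbb{H}$ be a complex Hilbert space and let $T\in B(\mathbb{H})$. Then $$w^2(T)\le\frac34\|T^2\|+\frac14\|T\|^2.$$
   Context: $B(\mathbb{H})$ is the set of bounded linear operators on $\mathbb{H}$, and $\|\cdot\|$ is the operator norm. The numerical radius of $T\in B(\mathbb{H})$ is $w(T)=\sup\{|\langle Tx,x\rangle| : x\in\mathbb{H},\ \|x\|=1\}$, and $w^2(T)$ means $(w(T))^2$. *)

(* Defs.v *)
From HB Require Import structures.
From mathcomp Require Import all_boot all_order all_algebra.
From mathcomp Require Import all_classical all_reals all_analysis.
From mathcomp Require Import complex.

Set Implicit Arguments.
Unset Strict Implicit.
Unset Printing Implicit Defensive.

Import Order.TTheory GRing.Theory Num.Theory.
Import numFieldNormedType.Exports.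

Local Open Scope classical_set_scope.
Local Open Scope ring_scope.
Local Open Scope complex_scope.

(* A complex Hilbert space: a Banach space over [R[i]] whose norm is induced by
   a positive definite Hermitian form.  As in [sesquilinear], the form is linear
   in its first argument and conjugate-linear in the second. *)
HB.mixin Record CompleteNormedModule_isHilbert (R : realType) (H : Type)
    of CompleteNormedModule R[i] H := {
  inner : {dot H for (@Num.conj R[i])} ;
  normr_inner : forall x : H, `|x| ^+ 2 = inner x x
}.

#[short(type="complexHilbertType")]
HB.structure Definition ComplexHilbert (R : realType) :=
  {H of CompleteNormedModule R[i] H & CompleteNormedModule_isHilbert R H}.

Section operators.
Context {R : realType} {H : complexHilbertType R}.
Implicit Types T : H -> H.

Definition bounded_operator T :=
  exists M : R, forall x : H, `|T x| <= M%:C * `|x|.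

(* The norms of [H] and of [R[i]] take their values in [R[i]], as nonnegative
   real elements; [complex.Re] reads them as elements of [R]. *)
Definition opnorm T : R :=
  sup [set complex.Re `|T x| | x in [set x : H | `|x| <= 1]].

(* If [H] is the zero space there is no unit vector, and [sup set0 = 0]. *)
Definition numerical_radius T : R :=
  sup [set complex.Re `|inner (T x) x| | x in [set x : H | `|x| = 1]].

End operators.

Lemma bounded_operatorE (R : realType) (H : complexHilbertType R)
  (T : {linear H -> H}) : bounded_operator T <-> continuous T.
Proof.
rewrite -linear_bounded_continuous linear_boundedP; split.
  move=> [M TM]; near=> r => x; apply: (le_trans (TM x)).
  by rewrite ler_wpM2r //; near: r; apply: nbhs_pinfty_ge; rewrite complex_real.
move=> /pinfty_ex_gt0 [M M0 TM]; exists (complex.Re M) => x.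
by rewrite RRe_real ?gtr0_real //; exact: TM.
Unshelve. all: by end_near. Qed.

(* Main.v *)
Require Import Defs.
From HB Require Import structures.
From mathcomp Require Import all_boot all_order all_algebra.
From mathcomp Require Import all_classical all_reals all_analysis.
From mathcomp Require Import complex ring lra.

Set Implicit Arguments.
Unset Strict Implicit.
Unset Printing Implicit Defensive.

Import Order.TTheory GRing.Theory Num.Theory.
Import numFieldNormedType.Exports.

Local Open Scope classical_set_scope.
Local Open Scope ring_scope.

(** Write [s = ||T^2||], [t = ||T||], and let [T'] be the adjoint of [T].  For a
    unit vector [x] with [z = <T x, x>], rotating [T] so that [z >= 0] gives
    [2 z = <x, T x + T' x>], hence by Cauchy-Schwarz
[[
      4 |z|^2 <= ||T x||^2 + ||T' x||^2 + 2 Re <T^2 x, x>.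
]]
    The last term is at most [2 s].  The first two are the quadratic form of
    [T' T + T T'], whose norm is at most [t^2 + s]: the norm of the column
    operator [x |-> (T x, T' x)] is that of its adjoint row operator
    [(u, v) |-> T' u + T v], and
[[
      ||T' u + T v||^2 <= t^2 (||u||^2 + ||v||^2) + 2 Re <T^2 v, u>
                       <= (t^2 + s) (||u||^2 + ||v||^2).
]]
    Thus [4 |z|^2 <= t^2 + 3 s], and the theorem follows by taking the supremum
    over [x].

    The adjoint enters only through the vectors [T' x] and [T' T x], each of
    which is paired with two given vectors and with itself.  So it is enough to
    represent the functional [<T -, w>] on the span of those two vectors, which
    needs one orthogonalization step ([riesz_pair]) rather than the Riesz
    theorem on the whole space.  The row and column argument is [column_bound],
    and the bound at a single unit vector is [modulus_inner_sqr_bound]. *)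

(** * Real-valued moduli and norms *)

Section real_valued_norms.
Context {R : realType}.

Lemma realcM (p q : R) : ((p * q)%:C = p%:C * q%:C)%C.
Proof. exact: rmorphM. Qed.

Lemma realcX (p : R) n : ((p ^+ n)%:C = p%:C ^+ n)%C.
Proof. exact: rmorphXn. Qed.

(** Norms on complex spaces are valued in [R[i]], whose order is partial;
    reading them in [R] gives access to linear arithmetic. *)
Definition modulus (z : R[i]) : R := complex.Re `|z|.

Lemma modulusC z : ((modulus z)%:C)%C = `|z|.
Proof. by rewrite RRe_real. Qed.

Lemma modulus_ge0 z : 0 <= modulus z.
Proof. by rewrite -ler0c modulusC. Qed.

Lemma Re_le_modulus z : complex.Re z <= modulus z.
Proof.
by apply: le_trans (ler_norm _) _; rewrite -lecR modulusC normc_ge_Re.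
Qed.

Lemma modulusN z : modulus (- z) = modulus z.
Proof. by rewrite /modulus normrN. Qed.

Lemma modulus0 : modulus 0 = 0.
Proof. by rewrite /modulus normr0. Qed.

Lemma modulus_real (p : R) : 0 <= p -> modulus p%:C%C = p.
Proof. by move=> p0; rewrite /modulus ger0_norm// ler0c. Qed.

Lemma modulus_sqr z : ((modulus z ^+ 2)%:C)%C = z * z^*.
Proof. by rewrite realcX modulusC normCK. Qed.

Lemma modulus_conj z : modulus z^* = modulus z.
Proof. by rewrite /modulus norm_conjC. Qed.

End real_valued_norms.

(** * Inner products *)

Section inner_product.
Context {R : realType} {H : complexHilbertType R}.
Implicit Types (x y u v b : H) (a : R[i]).

Definition rnorm x : R := complex.Re `|x|.

Lemma rnormC x : ((rnorm x)%:C)%C = `|x|.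
Proof. by rewrite RRe_real. Qed.

Lemma rnorm_ge0 x : 0 <= rnorm x.
Proof. by rewrite -ler0c rnormC. Qed.

Lemma rnorm_eq0 x : (rnorm x == 0) = (x == 0).
Proof. by rewrite -(inj_eq (@complexI R)) rnormC normr_eq0. Qed.

Lemma rnormZ a x : rnorm (a *: x) = modulus a * rnorm x.
Proof.
by apply: (@complexI R); rewrite realcM !rnormC modulusC normrZ.
Qed.

Lemma innerDl x y u : inner (x + y) u = inner x u + inner y u.
Proof. exact: linearDl. Qed.

Lemma innerDr u x y : inner u (x + y) = inner u x + inner u y.
Proof. exact: linearDr. Qed.

Lemma innerZl a x u : inner (a *: x) u = a * inner x u.
Proof. exact: linearZl_LR. Qed.

Lemma innerZr a u x : inner u (a *: x) = a^* * inner u x.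
Proof. exact: linearZr_LR. Qed.

Lemma innerC x y : inner x y = (inner y x)^*.
Proof. by rewrite [LHS]hermC expr0 mul1r. Qed.

Lemma inner0r u : inner u 0 = 0.
Proof. by rewrite -(scale0r 0) innerZr conjC0 mul0r. Qed.

Lemma inner_rnorm x : inner x x = (rnorm x ^+ 2)%:C%C.
Proof. by rewrite realcX rnormC normr_inner. Qed.

Lemma Re_innerC x y : complex.Re (inner x y) = complex.Re (inner y x).
Proof. by rewrite innerC; case: (inner y x). Qed.

Lemma rnormD_sqr u v : rnorm (u + v) ^+ 2 =
  rnorm u ^+ 2 + rnorm v ^+ 2 + 2 * complex.Re (inner u v).
Proof.
apply: (@complexI R); rewrite -inner_rnorm innerDl !innerDr !inner_rnorm.
rewrite (innerC v u); case: (inner u v) => p q.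
by apply/eqP; rewrite eq_complex /=; apply/andP; split; apply/eqP; simpl; ring.
Qed.

(** Cauchy-Schwarz, from the nonnegativity of the squared norm of
    [||y||^2 x - <x, y> y]; the space may have infinite dimension. *)
Lemma modulus_inner_le x y : modulus (inner x y) <= rnorm x * rnorm y.
Proof.
set z := inner x y.
rewrite -(@ler_pXn2r _ 2) ?nnegrE ?modulus_ge0 ?mulr_ge0 ?rnorm_ge0//.
have [y0|y0] := eqVneq y 0.
  by rewrite /z y0 inner0r modulus0 expr0n sqr_ge0.
have Y0 : 0 < rnorm y ^+ 2 by rewrite exprn_gt0// lt_def rnorm_eq0 y0 rnorm_ge0.
have := sqr_ge0 (rnorm ((rnorm y ^+ 2)%:C%C *: x + (- z) *: y)).
rewrite rnormD_sqr !rnormZ innerZl innerZr rmorphN mulNr -/z (mulrC z^*).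
rewrite -modulus_sqr mulrN -realcM modulusN modulus_real ?sqr_ge0//.
rewrite ![complex.Re _]/=.
by rewrite -(ler_pM2l Y0) !exprMn; lra.
Qed.

Lemma Re_inner_le x y : complex.Re (inner x y) <= rnorm x * rnorm y.
Proof. exact: le_trans (Re_le_modulus _) (modulus_inner_le x y). Qed.

(** The representing vector is built on the orthogonal pair [x], [e], where [e]
    is the component of [y] orthogonal to [x].  It lies in their span, which is
    why it also represents [f] at itself. *)
Lemma riesz_pair (f : H -> R[i]) x y : scalar f ->
  exists b, [/\ f x = inner x b, f y = inner y b & f b = inner b b].
Proof.
move=> flin.
have f0 : f 0 = 0.
  by have := flin (-1) 0 0; rewrite scaler0 addr0 mulN1r => ->; rewrite addNr.
have fD u v : f (u + v) = f u + f v.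
  by have := flin 1 u v; rewrite scale1r mul1r.
have fZ a u : f (a *: u) = a * f u.
  by have := flin a u 0; rewrite f0 !addr0.
(* When [x], or the orthogonal component of [y], vanishes, its coefficient is a
   division by zero, and the quantity it has to reproduce is zero too. *)
have divK v w : w = 0 \/ v != 0 -> w / inner v v * inner v v = w.
  case=> [->|v0]; first by rewrite !mul0r.
  by rewrite divfK// inner_rnorm (inj_eq (@complexI R)) expf_eq0 rnorm_eq0.
pose k := inner y x / inner x x.
pose e := y - k *: x.
have ex : inner e x = 0.
  rewrite /e -scaleNr innerDl innerZl mulNr /k divK ?subrr//.
  have [->|] := eqVneq x 0; [left|by right].
  by rewrite inner0r.
have xe : inner x e = 0 by rewrite innerC ex conjC0.
have ye : y = e + k *: x by rewrite /e subrK.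
have fdivK v : f v / inner v v * inner v v = f v.
  by apply: divK; have [->|] := eqVneq v 0; [left; rewrite f0|right].
pose b := (f x / inner x x)^* *: x + (f e / inner e e)^* *: e.
have xb : f x = inner x b.
  by rewrite innerDr !innerZr xe mulr0 addr0 conjCK fdivK.
have eb : f e = inner e b.
  by rewrite innerDr !innerZr ex mulr0 add0r conjCK fdivK.
exists b; split => //.
  by rewrite ye fD fZ innerDl innerZl -xb -eb.
have bl w : inner b w =
    (f x / inner x x)^* * inner x w + (f e / inner e e)^* * inner e w.
  by rewrite innerDl !innerZl.
by rewrite bl -xb -eb fD !fZ.
Qed.

End inner_product.

(** * Pointwise operator inequalities *)

Section operator_inequalities.
Context {R : realType} {H : complexHilbertType R}.
Context (T : {linear H -> H}) (t s : R).
Context (s_ge0 : 0 <= s)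
  (Tt : forall y, rnorm (T y) <= t * rnorm y)
  (Ts : forall y, rnorm (T (T y)) <= s * rnorm y).

Lemma scalar_inner_comp (w : H) : scalar (fun y => inner (T y) w).
Proof. by move=> a u v; rewrite linearP innerDl innerZl. Qed.

(** Here [b] plays the role of [T' x], for [T'] the adjoint of [T].  With [N]
    the left-hand side, the vector [c + T b], where [c] stands for [T' (T x)], pairs
    with [x] to [N], while its squared norm is at most [(t^2 + s) N]: the cross
    term is [<T^2 b, T x>], and the arithmetic-geometric mean inequality absorbs
    it.  So [N^2 <= ||x||^2 (t^2 + s) N]. *)
Lemma column_bound (x b : H) : inner (T b) x = inner b b ->
  rnorm (T x) ^+ 2 + rnorm b ^+ 2 <= (t ^+ 2 + s) * rnorm x ^+ 2.
Proof.
move=> hb.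
have [c [xc Tbc cc]] := riesz_pair x (T b) (scalar_inner_comp (T x)).
have N_le : rnorm (T x) ^+ 2 + rnorm b ^+ 2 <= rnorm x * rnorm (c + T b).
  apply: le_trans (Re_inner_le _ _).
  by rewrite innerDr raddfD/= -xc (Re_innerC x) hb !inner_rnorm.
have c_le : rnorm c <= t * rnorm (T x).
  have := Re_inner_le (T c) (T x); rewrite cc inner_rnorm /= => h.
  have := rnorm_ge0 c; rewrite le_eqVlt => /predU1P[<-|c0].
    exact: le_trans (rnorm_ge0 _) (Tt (T x)).
  rewrite -(ler_pM2l c0) -expr2 (le_trans h)//.
  by rewrite mulrA (mulrC (rnorm c)) ler_wpM2r ?rnorm_ge0.
have cTb : complex.Re (inner c (T b)) <= s * rnorm b * rnorm (T x).
  rewrite Re_innerC -Tbc; apply: le_trans (Re_inner_le _ _) _.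
  by rewrite ler_wpM2r ?rnorm_ge0.
have cb_le : rnorm (c + T b) ^+ 2 <=
    (t ^+ 2 + s) * (rnorm (T x) ^+ 2 + rnorm b ^+ 2).
  rewrite rnormD_sqr.
  have c2 : rnorm c ^+ 2 <= (t * rnorm (T x)) ^+ 2.
    by rewrite lerXn2r ?nnegrE ?rnorm_ge0// (le_trans (rnorm_ge0 _) c_le).
  have b2 : rnorm (T b) ^+ 2 <= (t * rnorm b) ^+ 2.
    by rewrite lerXn2r ?nnegrE ?rnorm_ge0// (le_trans (rnorm_ge0 _) (Tt b)).
  have := mulr_ge0 s_ge0 (sqr_ge0 (rnorm b - rnorm (T x))).
  rewrite !exprMn in c2 b2; lra.
(* Cancelling [N] in the quadratic inequality requires [N] to be nonzero. *)
set N := _ + _ in N_le cb_le *.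
have : 0 <= N by rewrite addr_ge0 ?sqr_ge0.
rewrite le_eqVlt => /predU1P[N0|N0].
  by rewrite -N0 mulr_ge0 ?addr_ge0 ?sqr_ge0.
rewrite -(ler_pM2r N0) -expr2.
apply: (@le_trans _ _ ((rnorm x * rnorm (c + T b)) ^+ 2)).
  by rewrite lerXn2r ?nnegrE ?(ltW N0) ?mulr_ge0 ?rnorm_ge0.
by rewrite exprMn; have := ler_wpM2l (sqr_ge0 (rnorm x)) cb_le; lra.
Qed.

(** With [b] standing for the adjoint of [T] at [x], the four quarters of the
    bound come from [||T x||^2 + ||b||^2 <= t^2 + s] and, for the cross term,
    [2 |<T^2 x, x>| <= 2 s]. *)
Lemma modulus_inner_sqr_bound (x : H) : rnorm x = 1 ->
  modulus (inner (T x) x) ^+ 2 <= 3 / 4 * s + 1 / 4 * t ^+ 2.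
Proof.
move=> x1.
have [b [xb Txb bb]] := riesz_pair x (T x) (scalar_inner_comp x).
have N_le := column_bound bb.
set z := inner (T x) x in xb *; set m := modulus z.
have mC : (m%:C)%C = `|z| by exact: modulusC.
have m_ge0 : 0 <= m by exact: modulus_ge0.
(* Weighting by [z^*] and [z] replaces the rotation making [z] real: both terms
   then pair with [x] to [|z|^2], with no division by [z]. *)
pose v := z^* *: T x + z *: b.
have xv : inner x v = ((2 * m ^+ 2)%:C)%C.
  rewrite innerDr !innerZr conjCK (innerC x (T x)) -/z -xb.
  rewrite (mulrC z^*) -normCK -mC -realcX -rmorphD/=.
  by congr (_%:C)%C; ring.
have v_le : rnorm v ^+ 2 <= m ^+ 2 * (t ^+ 2 + 3 * s).
  rewrite rnormD_sqr !rnormZ modulus_conj -/m !exprMn.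
  have : complex.Re (inner (z^* *: T x) (z *: b)) <= m ^+ 2 * s.
    (* Moving the scalars back onto [T (T x)] leaves a single inner product. *)
    rewrite innerZl innerZr -Txb mulrA -innerZl.
    apply: le_trans (Re_inner_le _ _) _; rewrite x1 mulr1 rnormZ.
    have -> : modulus (z^* * z^*) = m ^+ 2.
      apply: (@complexI R).
      by rewrite modulusC normrM norm_conjC realcX mC expr2.
    by rewrite ler_wpM2l ?sqr_ge0// (le_trans (Ts x))// x1 mulr1.
  have := ler_wpM2l (sqr_ge0 m) N_le; rewrite x1; lra.
have := Re_inner_le x v; rewrite xv x1 mul1r /= => h.
have h2 : (2 * m ^+ 2) ^+ 2 <= rnorm v ^+ 2.
  by rewrite lerXn2r ?nnegrE ?rnorm_ge0// mulr_ge0 ?sqr_ge0 ?ler0n.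
have [m00|m0] := eqVneq m 0.
  by rewrite m00 expr0n addr_ge0// mulr_ge0 ?sqr_ge0.
have m2 : 0 < m ^+ 2 by rewrite exprn_gt0// lt_def m0.
rewrite -(ler_pM2l m2); lra.
Qed.

End operator_inequalities.

(** * Operator norm and numerical radius as suprema *)

Section opnorm.
Context {R : realType} {H : complexHilbertType R}.
Implicit Type T : {linear H -> H}.

Lemma opnorm_has_ubound T : bounded_operator T ->
  has_ubound [set complex.Re `|T x| | x in [set x : H | `|x| <= 1]].
Proof.
move=> [M TM]; exists `|M| => _ [x /= x1 <-].
(* The given bound [M] may be negative when [H] is the zero space. *)
have TxM : rnorm (T x) <= M * rnorm x by rewrite -lecR realcM !rnormC.
have xle1 : rnorm x <= 1 by rewrite -lecR rnormC.
apply: le_trans TxM _; rewrite (le_trans (ler_norm _))// normrM.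
by rewrite (ger0_norm (rnorm_ge0 x)) ler_piMr.
Qed.

Lemma opnorm_ge0 T : bounded_operator T -> 0 <= opnorm T.
Proof.
move=> /opnorm_has_ubound /ub_le_sup; apply.
by exists (0 : H); [rewrite /= normr0 ler01|rewrite linear0 normr0].
Qed.

Lemma le_opnorm T : bounded_operator T ->
  forall x, rnorm (T x) <= opnorm T * rnorm x.
Proof.
move=> hT x.
have [->|x0] := eqVneq x 0.
  by rewrite linear0 (eqP (_ : rnorm (0 : H) == 0)) ?rnorm_eq0// mulr0.
have nx0 : 0 < rnorm x by rewrite lt_def rnorm_eq0 x0 rnorm_ge0.
rewrite -ler_pdivrMr// mulrC.
have nV : modulus ((rnorm x)^-1%:C%C) = (rnorm x)^-1.
  by rewrite modulus_real// invr_ge0 ltW.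
apply: ub_le_sup; first exact: opnorm_has_ubound.
exists ((rnorm x)^-1%:C%C *: x).
  by rewrite /= -rnormC rnormZ nV mulVf ?gt_eqF.
by rewrite linearZ -/(rnorm _) rnormZ nV.
Qed.

Lemma bounded_operator_comp T : bounded_operator T -> bounded_operator (T \o T).
Proof.
move=> hT; exists (opnorm T ^+ 2) => x; rewrite -!rnormC -realcM lecR.
rewrite (le_trans (le_opnorm hT (T x)))// expr2 -mulrA.
by rewrite ler_wpM2l ?opnorm_ge0 ?le_opnorm.
Qed.

Lemma inner_has_ubound T : bounded_operator T ->
  has_ubound [set complex.Re `|inner (T x) x| | x in [set x : H | `|x| = 1]].
Proof.
move=> hT; exists (opnorm T) => _ [x /= x1 <-].
have rx1 : rnorm x = 1 by rewrite /rnorm x1.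
apply: le_trans (modulus_inner_le (T x) x) _.
by rewrite rx1 mulr1 (le_trans (le_opnorm hT x))// rx1 mulr1.
Qed.

End opnorm.

Theorem theorem2p9 (R : realType) (H : complexHilbertType R)
    (T : {linear H -> H}) (hT : bounded_operator T) :
  numerical_radius T ^+ 2 <=
    3 / 4 * opnorm (T \o T) + 1 / 4 * opnorm T ^+ 2.
Proof.
have hTT := bounded_operator_comp hT.
have s_ge0 := opnorm_ge0 hTT.
set K := leRHS.
have K_ge0 : 0 <= K by rewrite addr_ge0// mulr_ge0 ?sqr_ge0.
(* On the zero space there is no unit vector, and the supremum is [sup set0]. *)
have [A0|/set0P A0] := eqVneq [set x : H | `|x| = 1] set0.
  by rewrite /numerical_radius A0 image_set0 sup0 expr0n.
rewrite -[leRHS]sqr_sqrtr// lerXn2r ?nnegrE ?sqrtr_ge0//.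
  have [x x1] := A0; apply: le_trans (modulus_ge0 (inner (T x) x)) _.
  by apply: ub_le_sup; [exact: inner_has_ubound|exists x].
apply: ge_sup; first exact: image_nonempty.
move=> _ [x /= x1 <-].
rewrite -(@ler_pXn2r _ 2) ?nnegrE ?sqrtr_ge0 ?modulus_ge0// sqr_sqrtr//.
apply: modulus_inner_sqr_bound => //.
- exact: le_opnorm.
- exact: (le_opnorm hTT).
- by rewrite /rnorm x1.
Qed.
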